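(* (1) If $(A,\wedge,\to,1)$ is a hemiimplicative semilattice and $a\leftrightarrow b := (a\to b)\wedge(b\to a)$, then $(A,\wedge,\leftrightarrow,1)$ is a symmetric hemiimplicative semilattice. (2) If $(A,\wedge,\to,1)$ is a hemiimplicative semilattice satisfying $a\to(a\wedge b)=a\to b$ for all $a,b\in A$, then $a\to b = a\Rightarrow b$ for every $a,b\in A$, where $\Rightarrow$ is the implication associated to the algebra $(A,\wedge,\leftrightarrow,1)$, i.e. $a\Rightarrow b := a\leftrightarrow(a\wedge b)$. (3) If $(A,\wedge,\sim,1)$ is a symmetric hemiimplicative semilattice and $a\Rightarrow b := a\sim(a\wedge b)$, then $(A,\wedge,\Rightarrow,1)$ is a hemiimplicative semilattice satisfying $a\Rightarrow(a\wedge b)=a\Rightarrow b$ for all $a,b\in A$.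
   Context: A hemiimplicative semilattice is an algebra $(A,\wedge,\to,1)$ of type $(2,2,0)$ such that: $(A,\wedge,1)$ is a meet-semilattice with greatest element $1$ (with order $a\le b$ iff $a\wedge b=a$); $a\to a=1$ for every $a\in A$; and for all $a,b,c\in A$, if $a\le b\to c$ then $a\wedge b\le c$. A symmetric hemiimplicative semilattice is a hemiimplicative semilattice $(A,\wedge,\sim,1)$ (with $\sim$ playing the role of $\to$) such that $a\sim b=b\sim a$ for all $a,b\in A$. *)

(* Defs.v *)
From mathcomp Require Import all_boot.
Set Implicit Arguments.
Unset Strict Implicit.
Unset Printing Implicit Defensive.

(** The carrier is an arbitrary [Type], with no decidable equality or choice
    operator, so the algebras are operations on it satisfying equations rather
    than instances of [tMeetSemilatticeType]. *)

Definition meet_le (A : Type) (meet : A -> A -> A) (a b : A) : Prop :=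
  meet a b = a.

Record is_bounded_meet_semilattice (A : Type)
    (meet : A -> A -> A) (one : A) : Prop := {
  bms_meetA : associative meet;
  bms_meetC : commutative meet;
  bms_meetxx : idempotent_op meet;
  bms_le1 : forall a : A, meet_le meet a one
}.

Record is_hemiimplicative_semilattice (A : Type)
    (meet imp : A -> A -> A) (one : A) : Prop := {
  his_semilattice : is_bounded_meet_semilattice meet one;
  his_impxx : forall a : A, imp a a = one;
  his_le_imp : forall a b c : A,
    meet_le meet a (imp b c) -> meet_le meet (meet a b) c
}.

Record is_symmetric_hemiimplicative_semilattice (A : Type)
    (meet sim : A -> A -> A) (one : A) : Prop := {
  shis_hemiimplicative : is_hemiimplicative_semilattice meet sim one;
  shis_simC : forall a b : A, sim a b = sim b a
}.

Definition biimp (A : Type) (meet imp : A -> A -> A) (a b : A) : A :=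
  meet (imp a b) (imp b a).

Definition assoc_imp (A : Type) (meet sim : A -> A -> A) (a b : A) : A :=
  sim a (meet a b).

(* Main.v *)
Require Import Defs.
From mathcomp Require Import all_boot.

(** Each new operation lies below, or reduces to, the old one. In (1), [biimp] is a meet with
    [imp b c] as a factor, so anything below it is below [imp b c]. In (2), the hypothesis turns
    [assoc_imp] into [imp a b] met with [imp (meet a b) a], and the latter factor is [one]. In (3),
    residuation for [sim] bounds [meet a b] by [meet b c], hence by [c]; the remaining identities
    are idempotence of [meet]. *)

Lemma meet_le_trans (A : Type) (meet : A -> A -> A) (a b c : A) :
  associative meet -> meet_le meet a b -> meet_le meet b c -> meet_le meet a c.
Proof. by rewrite /meet_le => mA <- bc; rewrite -mA bc. Qed.

Lemma meet_le_l (A : Type) (meet : A -> A -> A) (one a b : A) :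
  is_bounded_meet_semilattice meet one -> meet_le meet (meet a b) a.
Proof.
by case=> mA mC mxx _; rewrite /meet_le (mC (meet a b)) mA mxx.
Qed.

Lemma meet_le_r (A : Type) (meet : A -> A -> A) (one a b : A) :
  is_bounded_meet_semilattice meet one -> meet_le meet (meet a b) b.
Proof. by move=> sl; rewrite (bms_meetC sl); apply: meet_le_l sl. Qed.

Theorem proposition3p10 (A : Type) (meet : A -> A -> A) (one : A) :
  (forall imp : A -> A -> A,
     is_hemiimplicative_semilattice meet imp one ->
     is_symmetric_hemiimplicative_semilattice meet (biimp meet imp) one)
  /\
  (forall imp : A -> A -> A,
     is_hemiimplicative_semilattice meet imp one ->
     (forall a b : A, imp a (meet a b) = imp a b) ->
     forall a b : A, imp a b = assoc_imp meet (biimp meet imp) a b)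
  /\
  (forall sim : A -> A -> A,
     is_symmetric_hemiimplicative_semilattice meet sim one ->
     is_hemiimplicative_semilattice meet (assoc_imp meet sim) one /\
     (forall a b : A,
        assoc_imp meet sim a (meet a b) = assoc_imp meet sim a b)).
Proof.
split; [|split] => [imp [sl impxx le_imp]|imp [sl impxx _] imp_meet a b
                   |sim [[sl simxx le_sim] _]].
- split=> [|a b]; last exact: (bms_meetC sl).
  split=> // [a|a b c a_le].
    by rewrite /biimp impxx (bms_meetxx sl).
  apply: le_imp; apply: meet_le_trans (bms_meetA sl) a_le _.
  exact: meet_le_l sl.
- have -> : assoc_imp meet (biimp meet imp) a b
            = meet (imp a b) (imp (meet a b) a).
    by rewrite /assoc_imp /biimp imp_meet.
  (* Used backwards, the hypothesis replaces the target [a] by [meet (meet a b) a], which is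
     [meet a b]; the factor becomes [imp x x], that is, [one]. *)
  rewrite -(imp_meet (meet a b) a) (meet_le_l _ _ _ a b sl) impxx.
  by rewrite (bms_le1 sl).
- split=> [|a b]; last first.
    by rewrite /assoc_imp (bms_meetA sl) (bms_meetxx sl).
  split=> // [a|a b c a_le].
    by rewrite /assoc_imp (bms_meetxx sl) simxx.
  (* The intermediate element is [meet b c], the second argument of [sim] in
     [assoc_imp meet sim b c]. *)
  apply: meet_le_trans (bms_meetA sl) (le_sim _ _ _ a_le) _.
  exact: meet_le_r sl.
Qed.
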